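(* If $n$ is an odd perfect number and $p_1$ is its smallest prime factor, then $$H(n)\leq 2+\frac{9}{4p_1^2}.$$
   Context: A positive integer $n$ is perfect if $\sigma(n)=2n$, where $\sigma(n)$ is the sum of the positive divisors of $n$. $H(n)=\prod_{p\mid n}\frac{p}{p-1}$, where $p$ runs over the distinct prime divisors of $n$. *)

(* Defs.v *)
From mathcomp Require Import all_boot all_order all_algebra.

Set Implicit Arguments.
Unset Strict Implicit.
Unset Printing Implicit Defensive.

Import GRing.Theory Num.Theory.

Local Open Scope ring_scope.

Definition sigma (n : nat) : nat := (\sum_(d <- divisors n) d)%N.

(* Positivity is needed: [divisors 0] is empty, so [sigma 0 = 2 * 0]. *)
Definition perfect (n : nat) : Prop := (0 < n)%N /\ sigma n = (2 * n)%N.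

(* [primes n] lists each prime divisor of n exactly once. *)
Definition H (n : nat) : rat := \prod_(p <- primes n) (p%:R / (p%:R - 1)).

(* Main.v *)
Require Import Defs.
From mathcomp Require Import all_boot all_order all_algebra.
From mathcomp Require Import zify ring lra.
Import Order.TTheory GRing.Theory Num.Theory.
Local Open Scope ring_scope.

(** Write n as the product of the p^a.  Since sigma n = 2 n, one has
    H(n) * \prod (1 - p^-(a+1)) = 2, and by Weierstrass' inequality the product
    is at least 1 - S, where S is the sum of the p^-(a+1).  If a is odd, p + 1
    divides sigma (p^a), hence 2 n; as n is odd, this happens for at most one
    prime q, and a prime factor of (q + 1) / 2 divides n, so that
    q >= 2 p1 - 1.  All other exponents are at least 2, and the sum of 1/m^3 over
    odd m >= p1 is at most 1 / (4 (p1 - 1)^2).  Hence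
    S <= 1 / (2 p1 - 1)^2 + 1 / (4 (p1 - 1)^2) <= 1 / p1^2, and
    2 / (1 - 1 / p1^2) <= 2 + 9 / (4 p1^2) because p1 >= 3. *)

(** * Multiplicativity of [sigma] and its values at prime powers *)

Lemma sigmaM (a b : nat) : (0 < a)%N -> (0 < b)%N -> coprime a b ->
  sigma (a * b) = (sigma a * sigma b)%N.
Proof.
move=> a0 b0 cab; rewrite /sigma.
(* Taking gcds with [a] and [b] recovers the pair from x * y; this makes the parametrization of the
   divisors injective. *)
have gcd_mul x y : (x %| a)%N -> (y %| b)%N -> gcdn (x * y) a = x.
  move=> xa yb; have cya : coprime a y by apply: coprime_dvdr cab.
  by rewrite gcdnC Gauss_gcdl // gcdnC; apply/gcdn_idPl.
have cba : coprime b a by rewrite coprime_sym.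
have gcd_mulr x y : (x %| a)%N -> (y %| b)%N -> gcdn (x * y) b = y.
  move=> xa yb; have cxb : coprime b x by apply: coprime_dvdr cba.
  by rewrite gcdnC Gauss_gcdr // gcdnC; apply/gcdn_idPl.
have perm_div : perm_eq (divisors (a * b))
    [seq (x * y)%N | x <- divisors a, y <- divisors b].
  apply: uniq_perm.
  - exact: divisors_uniq.
  - apply: allpairs_uniq; [exact: divisors_uniq | exact: divisors_uniq |].
    move=> [x y] [x' y'] /allpairsP[[u v] [ua vb [-> ->]]].
    move=> /allpairsP[[u' v'] [ua' vb' [-> ->]]] /= e.
    rewrite -!dvdn_divisors //= in ua vb ua' vb'.
    congr (_, _).
      by rewrite -(gcd_mul u v) // e gcd_mul.
    by rewrite -(gcd_mulr u v) // e gcd_mulr.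
  move=> d; rewrite -dvdn_divisors ?muln_gt0 ?a0 //.
  apply/idP/allpairsP => [dab | [[x y] [/= xa yb ->]]].
    exists (gcdn d a, gcdn d b); rewrite -!dvdn_divisors // !dvdn_gcdr.
    split=> //=; apply/eqP; rewrite eqn_dvd; apply/andP; split.
      (* The product of the two gcds is the gcd of d * d, d * b, a * d and a * b, all multiples of
         d. *)
      rewrite muln_gcdl !muln_gcdr !dvdn_gcd dab.
      by rewrite (dvdn_mulr _ (dvdnn d)) (dvdn_mulr _ (dvdnn d)) (dvdn_mull _ (dvdnn d)).
    rewrite Gauss_dvd ?dvdn_gcdl //.
    exact: coprime_dvdl (dvdn_gcdr d a) (coprime_dvdr (dvdn_gcdr d b) cab).
  by apply: dvdn_mul; rewrite dvdn_divisors.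
rewrite (perm_big _ perm_div) big_allpairs_dep /= big_distrl /=.
by apply: eq_bigr => x _; rewrite big_distrr.
Qed.

(** The list and the exponents are arbitrary so that induction on the list applies. *)
Lemma sigma_prod_primes (r : seq nat) (e : nat -> nat) :
  uniq r -> all prime r ->
  sigma (\prod_(p <- r) p ^ e p) = (\prod_(p <- r) sigma (p ^ e p))%N.
Proof.
elim: r => [|p r IHr] /=; first by rewrite !big_nil /sigma big_seq1.
case/andP=> pr ur /andP[p_pr allr].
rewrite !big_cons sigmaM ?IHr //; first by rewrite expn_gt0 prime_gt0.
  rewrite big_seq; apply: prodn_cond_gt0 => q /(allP allr) q_pr.
  by rewrite expn_gt0 prime_gt0.
rewrite big_seq; elim/big_rec: _ => [|q x qr cx]; first exact: coprimen1.
rewrite coprimeMr cx andbT coprimeXl // coprimeXr //.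
rewrite prime_coprime // dvdn_prime2 ?(allP allr q qr) //.
by apply: contraNneq pr => ->.
Qed.

Lemma sigma_decomp (n : nat) : (0 < n)%N ->
  sigma n = (\prod_(p <- primes n) sigma (p ^ logn p n))%N.
Proof.
move=> n0; rewrite -sigma_prod_primes ?primes_uniq ?all_prime_primes //.
by rewrite {1}(prod_prime_decomp n0) prime_decompE big_map.
Qed.

Lemma sigma_pfactor (p a : nat) : prime p ->
  sigma (p ^ a) = (\sum_(i < a.+1) p ^ i)%N.
Proof.
move=> p_pr; rewrite /sigma.
have perm_div : perm_eq (divisors (p ^ a)) [seq (p ^ i)%N | i <- iota 0 a.+1].
  apply: uniq_perm; first exact: divisors_uniq.
    rewrite map_inj_uniq ?iota_uniq //.
    by move=> i j; apply: expnI; exact: prime_gt1.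
  move=> d; rewrite -dvdn_divisors ?expn_gt0 ?prime_gt0 //.
  apply/(dvdn_pfactor _ _ p_pr)/mapP => [[i ia ->] | [i ia ->]]; exists i => //;
    by move: ia; rewrite mem_iota.
by rewrite (perm_big _ perm_div) big_map -[iota 0 _]/(index_iota 0 a.+1) big_mkord.
Qed.

(** For odd a the sum 1 + p + ... + p^a has an even number of terms, and consecutive ones pair up as
    p^i + p^(i+1) = p^i (p + 1). *)
Lemma dvdn_sigma_pfactor_odd (p a : nat) : prime p -> odd a ->
  (p.+1 %| sigma (p ^ a))%N.
Proof.
move=> p_pr odd_a; rewrite sigma_pfactor // -(odd_double_half a) odd_a.
elim: a./2 => [|k IHk]; first by rewrite !big_ord_recr big_ord0 /= !add0n.
rewrite doubleS !addnS big_ord_recr big_ord_recr /= -addnA dvdn_addr //.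
by rewrite expnS -mulSn dvdn_mulr.
Qed.

Lemma sigma_pfactor_rat (p a : nat) : prime p ->
  (p%:R / (p%:R - 1)) * (1 - p%:R ^- a.+1) =
  (sigma (p ^ a))%:R / (p%:R ^+ a) :> rat.
Proof.
move=> p_pr; have p1 : (1 < p)%N := prime_gt1 p_pr.
have pn0 : p%:R != 0 :> rat by rewrite pnatr_eq0; lia.
have pm1 : p%:R - 1 != 0 :> rat by rewrite subr_eq0 pnatr_eq1; lia.
have geo : p%:R ^+ a.+1 - 1 = (p%:R - 1) * (sigma (p ^ a))%:R :> rat.
  rewrite subrX1 sigma_pfactor // natr_sum; congr (_ * _).
  by apply: eq_bigr => i _; rewrite natrX.
have pX0 : p%:R ^+ a != 0 :> rat by rewrite expf_neq0.
have -> : 1 - p%:R ^- a.+1 = (p%:R ^+ a.+1 - 1) / p%:R ^+ a.+1 :> rat.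
  by rewrite mulrBl divff ?expf_neq0 // mul1r.
by rewrite geo exprS; field; rewrite pn0 pm1 pX0.
Qed.

(** * Bounds for finite products and sums *)

Lemma prod_1B_ge (R : realDomainType) (I : eqType) (r : seq I) (x : I -> R) :
  (forall i, i \in r -> 0 <= x i <= 1) ->
  1 - \sum_(i <- r) x i <= \prod_(i <- r) (1 - x i).
Proof.
(* The upper bound P <= 1 on the product strengthens the induction: it gives (1 - x) P >= P - x. *)
move=> x01; suff: 1 - \sum_(i <- r) x i <= \prod_(i <- r) (1 - x i) <= 1.
  by case/andP.
have : 0 <= \sum_(i <- r) x i.
  by rewrite big_seq sumr_ge0 // => i /x01/andP[].
elim: r x01 => [|i r IHr] x01; rewrite ?big_nil ?big_cons; first by lra.
have xr j : j \in r -> 0 <= x j <= 1 by move=> jr; apply: x01; rewrite inE jr orbT.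
have S0 : 0 <= \sum_(j <- r) x j by rewrite big_seq sumr_ge0 // => j /xr/andP[].
have P0 : 0 <= \prod_(j <- r) (1 - x j).
  by rewrite big_seq prodr_ge0 // => j /xr /andP[]; rewrite subr_ge0.
have /andP[P1 P2] := IHr xr S0.
have /andP[x0 x1] := x01 i (mem_head _ _).
move=> _; apply/andP; split; nra.
Qed.

(** Telescoping: with g(m) = 1 / (4 (m - 1)^2) one has 1/m^3 <= g(m) - g(m + 2), and after m the
    next odd entry is at least m + 2. *)
Lemma sum_inv_cube_odd (s : seq nat) (M : nat) : (1 < M)%N ->
  sorted ltn s -> all odd s -> all (leq M) s ->
  \sum_(m <- s) (m%:R ^- 3) <= 1 / (4 * (M%:R - 1) ^+ 2) :> rat.
Proof.
elim: s M => [|m s IHs] M M1 /=.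
  by rewrite big_nil divr_ge0 // mulr_ge0 // sqr_ge0.
move=> ms /andP[odd_m odd_s] /andP[Mm Ms].
have m1 : (1 < m)%N by lia.
have IH : \sum_(j <- s) (j%:R ^- 3) <= 1 / (4 * (m.+2%:R - 1) ^+ 2) :> rat.
  apply: IHs => //; first exact: path_sorted ms.
  apply/allP=> j js.
  have := allP odd_s j js; have := allP (order_path_min ltn_trans ms) j js.
  by lia.
rewrite big_cons; apply: le_trans (lerD (lexx _) IH) _.
have mR : (2 : rat) <= m%:R by rewrite ler_nat.
have MR : (2 : rat) <= M%:R by rewrite ler_nat.
have MmR : (M%:R : rat) <= m%:R by rewrite ler_nat.
have -> : m.+2%:R = m%:R + 2 :> rat by rewrite -addn2 natrD.
move: (m%:R : rat) (M%:R : rat) mR MR MmR => x y x2 y2 yx.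
(* First the telescoping inequality at the head of the list, then monotonicity of g to pass from the
   head down to M. *)
apply: (@le_trans _ _ (1 / (4 * (x - 1) ^+ 2))).
  rewrite -subr_ge0.
  have -> : 1 / (4 * (x - 1) ^+ 2) - (x ^- 3 + 1 / (4 * (x + 2 - 1) ^+ 2)) =
    (2 * x ^+ 2 - 1) / (x ^+ 3 * (x - 1) ^+ 2 * (x + 1) ^+ 2).
    by field; apply/and3P; split; lra.
  apply: divr_ge0; first by nra.
  by rewrite !mulr_ge0 ?exprn_ge0 //; lra.
rewrite !div1r lef_pV2 ?posrE.
- by rewrite ler_pM2l // lerXn2r ?nnegrE //; lra.
- by rewrite mulr_gt0 // exprn_gt0 //; lra.
- by rewrite mulr_gt0 // exprn_gt0 //; lra.
Qed.

(** * Odd exponents in an odd perfect number *)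

Lemma perfect_odd_logn_count (n : nat) : odd n -> perfect n ->
  (count (fun p => odd (logn p n)) (primes n) <= 1)%N.
Proof.
move=> n_odd [n0 n_perf].
(* Each odd exponent contributes an even factor p + 1 to sigma n = 2 n, whose 2-adic valuation is
   1. *)
have dvd2 : (2 ^ count (fun p => odd (logn p n)) (primes n) %| 2 * n)%N.
  rewrite -n_perf sigma_decomp //.
  have odd_pr p : p \in primes n -> prime p && odd p.
    by rewrite mem_primes => /and3P[-> _ /dvdn_odd->].
  elim: (primes n) odd_pr => [|p r IHr] odd_pr /=; first by rewrite dvd1n.
  rewrite big_cons expnD dvdn_mul ?IHr //; last first.
    by move=> q qr; rewrite odd_pr // inE qr orbT.
  have /andP[p_pr p_odd] := odd_pr p (mem_head _ _).
  case odd_a: (odd _); last exact: dvd1n.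
  apply: (@dvdn_trans p.+1); last exact: dvdn_sigma_pfactor_odd p_pr odd_a.
  by rewrite expn1 dvdn2 /= p_odd.
move: dvd2; rewrite pfactor_dvdn ?muln_gt0 // lognM // logn_prime // eqxx.
by rewrite lognE dvdn2 n_odd andbF addn0.
Qed.

Lemma perfect_odd_logn_ge (n p1 q : nat) : odd n -> perfect n ->
  (forall p : nat, prime p -> (p %| n)%N -> (p1 <= p)%N) ->
  q \in primes n -> odd (logn q n) -> (2 * p1 <= q.+1)%N.
Proof.
move=> n_odd [n0 n_perf] p1_min qn odd_a.
have := qn; rewrite mem_primes => /and3P[q_pr _ q_dvd].
have q_odd := dvdn_odd q_dvd n_odd.
have q1 := prime_gt1 q_pr.
have hE : q.+1 = (2 * (q.+1)./2)%N by lia.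
have h_dvd : ((q.+1)./2 %| n)%N.
  rewrite -(@dvdn_pmul2l 2) // -hE -n_perf sigma_decomp //.
  by rewrite (big_rem q) //= dvdn_mulr // dvdn_sigma_pfactor_odd.
(* Since q >= 3, the number (q + 1) / 2 has a prime factor; it divides n, so it is at least p1. *)
have h1 : (1 < (q.+1)./2)%N by lia.
rewrite hE leq_mul2l /=.
apply: leq_trans (p1_min _ (pdiv_prime h1) _) (pdiv_leq _); last by lia.
exact: dvdn_trans (pdiv_dvd _) h_dvd.
Qed.

(** * The product identity for [H] and the final numerical inequalities *)

Lemma H_mul_prod (n : nat) : (0 < n)%N ->
  H n * \prod_(p <- primes n) (1 - p%:R ^- (logn p n).+1) =
  (sigma n)%:R / n%:R.
Proof.
move=> n0; have n_eq : n%:R = \prod_(p <- primes n) (p ^ logn p n)%:R :> rat.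
  by rewrite -natr_prod {1}(prod_prime_decomp n0) prime_decompE big_map.
rewrite n_eq sigma_decomp // natr_prod -prodf_div /H -big_split /=.
rewrite big_seq [RHS]big_seq; apply: eq_bigr => p.
by rewrite mem_primes => /andP[p_pr _]; rewrite sigma_pfactor_rat // natrX.
Qed.

Lemma inv_sqr_bound (F : realFieldType) (x : F) : 3 <= x ->
  1 / (4 * (x - 1) ^+ 2) + 1 / (2 * x - 1) ^+ 2 <= 1 / x ^+ 2.
Proof.
move=> x3.
rewrite -subr_ge0.
(* Expanded in powers of x - 3, the numerator has only positive coefficients. *)
have -> : 1 / x ^+ 2 - (1 / (4 * (x - 1) ^+ 2) + 1 / (2 * x - 1) ^+ 2) =
    (8 * (x - 3) ^+ 4 + 60 * (x - 3) ^+ 3 + 155 * (x - 3) ^+ 2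
       + 150 * (x - 3) + 31) / (4 * x ^+ 2 * (x - 1) ^+ 2 * (2 * x - 1) ^+ 2).
  by field; apply/and3P; split; lra.
have y0 : 0 <= x - 3 by lra.
by rewrite divr_ge0 ?addr_ge0 ?mulr_ge0 ?exprn_ge0 ?sqr_ge0 //; lra.
Qed.

(** With y = x^2, the hypothesis gives h <= 2 y / (y - 1) = 2 + 2 / (y - 1), and 2 / (y - 1) <= 9 /
    (4 y) exactly when y >= 9. The constant 9/4 is thus attained at x = 3. *)
Lemma le_of_mul_1B_inv_sqr (F : realFieldType) (h x : F) : 3 <= x ->
  h * (1 - 1 / x ^+ 2) <= 2 -> h <= 2 + 9 / (4 * x ^+ 2).
Proof.
move=> x3; have xx : 9 <= x ^+ 2 by nra.
move: (x ^+ 2) xx => y y9 h_le.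
have {h_le} : h * (y - 1) <= 2 * y.
  have -> : h * (y - 1) = h * (1 - 1 / y) * y by field; lra.
  by rewrite ler_wpM2r //; lra.
rewrite -ler_pdivlMr; last by lra.
move/le_trans; apply; rewrite -subr_ge0.
have -> : 2 + 9 / (4 * y) - 2 * y / (y - 1) = (y - 9) / (4 * y * (y - 1)).
  by field; apply/andP; split; lra.
by rewrite divr_ge0 ?mulr_ge0 //; lra.
Qed.

Theorem proposition6 (n p1 : nat) (n_odd : odd n) (n_perfect : perfect n)
    (p1_prime : prime p1) (p1_dvd : (p1 %| n)%N)
    (p1_min : forall p : nat, prime p -> (p %| n)%N -> (p1 <= p)%N) :
  H n <= 2 + 9 / (4 * p1%:R ^+ 2).
Proof.
have [n0 n_perf] := n_perfect.
have p1_odd := dvdn_odd p1_dvd n_odd.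
have p1_ge3 : (2 < p1)%N by have := prime_gt1 p1_prime; lia.
have P3 : (3 : rat) <= p1%:R by rewrite ler_nat.
pose c : rat := 1 / (2 * p1%:R - 1) ^+ 2.
have c0 : 0 <= c by rewrite divr_ge0 // sqr_ge0.
have primes1 p : p \in primes n -> (1 : rat) < p%:R.
  by rewrite mem_primes ltr1n => /andP[/prime_gt1].
(* The summand p^-3 is kept for the exceptional prime too, so that the cubes are summed over all of
   [primes n]. *)
have term p : p \in primes n ->
    p%:R ^- (logn p n).+1 <= p%:R ^- 3 + (if odd (logn p n) then c else 0) :> rat.
  move=> pn; have p_gt1 := primes1 p pn; have p_gt0 := lt_trans ltr01 p_gt1.
  case odd_a: (odd _).
    have := perfect_odd_logn_ge _ _ _ n_odd n_perfect p1_min pn odd_a => le_p.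
    rewrite -[leLHS]add0r; apply: lerD; first by rewrite invr_ge0 exprn_ge0 // ltW.
    have a0 := odd_gt0 odd_a.
    have leR : 2 * p1%:R - 1 <= p%:R :> rat.
      by rewrite lerBlDr -natrM -[1]/(1%:R) -natrD ler_nat addn1.
    rewrite /c div1r lef_pV2 ?posrE ?exprn_gt0 //; last by lra.
    apply: (@le_trans _ _ (p%:R ^+ 2)).
      by rewrite lerXn2r ?nnegrE //; lra.
    by rewrite ler_eXn2l.
  (* An even positive exponent is at least 2. *)
  have a2 : (2 <= logn p n)%N.
    by move: pn; rewrite -logn_gt0; lia.
  by rewrite addr0 lef_pV2 ?posrE ?exprn_gt0 // ler_eXn2l.
have S_le : \sum_(p <- primes n) p%:R ^- (logn p n).+1 <=
    1 / (4 * (p1%:R - 1) ^+ 2) + c :> rat.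
  rewrite big_seq; apply: le_trans (ler_sum _ term) _.
  rewrite -big_seq big_split /=; apply: lerD.
    apply: sum_inv_cube_odd; [by lia | exact: sorted_primes | |].
      by apply/allP=> p; rewrite mem_primes => /and3P[_ _ /dvdn_odd->].
    by apply/allP=> p; rewrite mem_primes => /and3P[p_pr _]; apply: p1_min.
  (* The remaining sum is [c] times the number of odd exponents, which is 0 or 1. *)
  rewrite -big_mkcond big_const_seq iter_addr_0.
  by have := perfect_odd_logn_count _ n_odd n_perfect; case: count => [|[]].
have S_bound : 1 / (4 * (p1%:R - 1) ^+ 2) + c <= 1 / p1%:R ^+ 2.
  exact: inv_sqr_bound.
have prod_ge : 1 - 1 / p1%:R ^+ 2 <=
    \prod_(p <- primes n) (1 - p%:R ^- (logn p n).+1) :> rat.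
  apply: le_trans (prod_1B_ge _ _ _ _ _); first by rewrite lerD2l lerN2 (le_trans S_le).
  move=> p /primes1 p_gt1; have p_gt0 := lt_trans ltr01 p_gt1.
  by rewrite invr_ge0 exprn_ge0 ?ltW //= invf_lt1 ?exprn_egt1 ?exprn_gt0.
have := H_mul_prod _ n0; rewrite n_perf natrM mulfK; last by rewrite pnatr_eq0; lia.
have H0 : 0 <= H n.
  rewrite /H big_seq prodr_ge0 // => p /primes1 p_gt1.
  by rewrite divr_ge0 //; lra.
move=> hQ; apply: le_of_mul_1B_inv_sqr => //.
by rewrite -hQ ler_wpM2l.
Qed.
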